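(* Let $\mathcal{H}$ be a set of first-order frame conditions, each of which is (the universal closure of) a Horn clause of the form $$w_1 R u_1 \wedge \ldots \wedge w_m R u_m \to Q ,$$ where $m\ge 0$ may depend on the clause, $w_i,u_i$ are (not necessarily distinct) variables ranging over worlds, and $Q$ is either $vRz$, or $v=z$ (for world variables $v,z$), or $\bot$. Let $\mathcal{C}_{\mathsf L}$ be the class of all Kripke frames satisfying every condition in $\mathcal{H}$. If a modal logic $\mathsf L$ is complete with respect to $\mathcal{C}_{\mathsf L}$, then $\mathsf L$ enjoys the Lyndon Interpolation Property (and hence also the Craig Interpolation Property).
   Context: Modal formulas are in negation normal form: they are built from positive propositional atoms $P$, negative propositional atoms $\overline{P}$ (for $P$ in a countable set $\mathsf{Prop}$), $\top$ and $\bot$ by $\wedge,\vee,\Box,\Diamond$. The negation $\overline{A}$ of a formula is defined via the De Morgan laws, and $A\to B:=\overline{A}\vee B$. A Kripke frame is a pair $(W,R)$ with $W\neq\varnothing$ and $R\subseteq W\times W$; a Kripke model is $(W,R,V)$ with $V:\mathsf{Prop}\to 2^W$. Satisfaction $\mathcal{M},w\Vdash A$ is standard. A modal logic $\mathsf L$ is complete w.r.t. a class of frames if it is characterized by it: $\mathsf L\vdash A$ iff $A$ holds at every world of every Kripke model whose frame is in the class. $\mathsf L$ has the Lyndon Interpolation Property (LIP) if whenever $\mathsf L\vdash A\to B$ there is a modal formula $C$ such that $\mathsf L\vdash A\to C$, $\mathsf L\vdash C\to B$, every positive propositional atom $P$ occurring in $C$ occurs (as a positive atom) in both $A$ and $B$,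 and every negative propositional atom $\overline{P}$ occurring in $C$ occurs in both $A$ and $B$. The Craig Interpolation Property (CIP) is the same with polarities disregarded. *)

(* Defs.v *)
From mathcomp Require Import all_boot.

Set Implicit Arguments.
Unset Strict Implicit.
Unset Printing Implicit Defensive.

Inductive form (Atom : Type) : Type :=
| Pos of Atom
| Neg of Atom
| Top
| Bot
| And of form Atom & form Atom
| Or of form Atom & form Atom
| Box of form Atom
| Dia of form Atom.

Arguments Top {Atom}.
Arguments Bot {Atom}.

Fixpoint dual (Atom : Type) (A : form Atom) : form Atom :=
  match A with
  | Pos p => Neg p
  | Neg p => Pos p
  | Top => Bot
  | Bot => Top
  | And A1 A2 => Or (dual A1) (dual A2)
  | Or A1 A2 => And (dual A1) (dual A2)
  | Box A1 => Dia (dual A1)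
  | Dia A1 => Box (dual A1)
  end.

Definition impl (Atom : Type) (A B : form Atom) : form Atom := Or (dual A) B.

Fixpoint pos_atoms (Atom : Type) (A : form Atom) : seq Atom :=
  match A with
  | Pos p => [:: p]
  | Neg _ | Top | Bot => [::]
  | And A1 A2 | Or A1 A2 => pos_atoms A1 ++ pos_atoms A2
  | Box A1 | Dia A1 => pos_atoms A1
  end.

Fixpoint neg_atoms (Atom : Type) (A : form Atom) : seq Atom :=
  match A with
  | Neg p => [:: p]
  | Pos _ | Top | Bot => [::]
  | And A1 A2 | Or A1 A2 => neg_atoms A1 ++ neg_atoms A2
  | Box A1 | Dia A1 => neg_atoms A1
  end.

Definition atoms (Atom : Type) (A : form Atom) : seq Atom :=
  pos_atoms A ++ neg_atoms A.

Record frame : Type := Frame {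
  world :> Type;
  acc : world -> world -> Prop;
  world_inhabited : inhabited world
}.

Record model (Atom : Type) : Type := Model {
  model_frame :> frame;
  val : Atom -> model_frame -> Prop
}.

Fixpoint sat (Atom : Type) (M : model Atom) (w : M) (A : form Atom) : Prop :=
  match A with
  | Pos p => val p w
  | Neg p => ~ val p w
  | Top => True
  | Bot => False
  | And A1 A2 => sat w A1 /\ sat w A2
  | Or A1 A2 => sat w A1 \/ sat w A2
  | Box A1 => forall u : M, acc w u -> sat u A1
  | Dia A1 => exists2 u : M, acc w u & sat u A1
  end.

(* World variables are natural numbers. *)
Inductive horn_head : Type :=
| HeadAcc of nat & nat
| HeadEq of nat & nat
| HeadBot.

(* The pair (w, u) in [body] stands for the atom w R u. *)
Record horn_clause : Type := HornClause {
  body : seq (nat * nat);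
  head : horn_head
}.

Definition head_holds (F : frame) (s : nat -> F) (Q : horn_head) : Prop :=
  match Q with
  | HeadAcc v z => acc (s v) (s z)
  | HeadEq v z => s v = s z
  | HeadBot => False
  end.

(* Worlds being inhabited, quantifying over all assignments amounts to the
   universal closure over the variables that actually occur in the clause. *)
Definition satisfies_clause (F : frame) (h : horn_clause) : Prop :=
  forall s : nat -> F,
    (forall w u : nat, (w, u) \in body h -> acc (s w) (s u)) ->
    head_holds s (head h).

Definition horn_class (H : horn_clause -> Prop) (F : frame) : Prop :=
  forall h : horn_clause, H h -> satisfies_clause F h.

(* A logic is identified with its set of theorems [L]. *)
Definition complete_wrt (Atom : Type) (L : form Atom -> Prop)
    (C : frame -> Prop) : Prop :=
  forall A : form Atom,
    L A <-> (forall M : model Atom, C M -> forall w : M, sat w A).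

Definition LIP (Atom : eqType) (L : form Atom -> Prop) : Prop :=
  forall A B : form Atom, L (impl A B) ->
  exists C : form Atom,
    [/\ L (impl A C), L (impl C B),
        forall p, p \in pos_atoms C ->
          p \in pos_atoms A /\ p \in pos_atoms B
      & forall p, p \in neg_atoms C ->
          p \in neg_atoms A /\ p \in neg_atoms B].

Definition CIP (Atom : eqType) (L : form Atom -> Prop) : Prop :=
  forall A B : form Atom, L (impl A B) ->
  exists C : form Atom,
    [/\ L (impl A C), L (impl C B)
      & forall p, p \in atoms C -> p \in atoms A /\ p \in atoms B].

(* Main.v *)
(* Suppose [A -> B] has no interpolant.  Then for every [n] there are models
   of [A] and of [dual B] that agree (in one direction) on the first [n] formulas
   of the common language.  Horn classes are closed under ultraproducts, so we
   obtain two modally saturated models of the class with points [x] of [A] and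
   [y] of [dual B] such that every common formula true at [x] is true at [y];
   by saturation this inclusion of theories is a back-and-forth relation [Z].
   Horn classes are also closed under products and substructures, so the
   substructure [Z] of the product of the two frames lies in the class, and a
   suitable valuation on it makes both [A] and [dual B] true at [(x, y)]. *)
Require Import Defs.
From mathcomp Require Import all_boot.
From mathcomp Require Import boolp classical_sets filter.

Set Implicit Arguments.
Unset Strict Implicit.
Unset Printing Implicit Defensive.

Local Open Scope classical_set_scope.

(** * Semantic and syntactic duality *)

Lemma sat_dual (Atom : Type) (M : model Atom) (A : form Atom) (w : M) :
  sat w (dual A) <-> ~ sat w A.
Proof.
elim: A w => [p|p|||A IHA B IHB|A IHA B IHB|A IHA|A IHA] w /=.
- by split.
- by split=> [? /(_ _)|/contrapT].
- by split=> // /(_ I).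
- by split=> // _ [].
- by rewrite IHA IHB not_andP.
- by rewrite IHA IHB not_orP.
- split=> [[u wu /IHA nA] /(_ u wu)//|/existsNP[u /not_implyP[wu nA]]].
  by exists u => //; apply/IHA.
- split=> [AN [u wu uA]|nA u wu]; first exact: (proj1 (IHA u) (AN u wu)).
  by apply/IHA => uA; apply: nA; exists u.
Qed.

Lemma sat_impl (Atom : Type) (M : model Atom) (A B : form Atom) (w : M) :
  sat w (impl A B) <-> (sat w A -> sat w B).
Proof.
rewrite /impl /= sat_dual; split=> [[//|//]|AB].
by have [/AB|] := EM (sat w A); [right|left].
Qed.

Lemma pos_atoms_dual (Atom : Type) (A : form Atom) :
  pos_atoms (dual A) = neg_atoms A.
Proof. by elim: A => //= A -> B ->. Qed.

Lemma neg_atoms_dual (Atom : Type) (A : form Atom) :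
  neg_atoms (dual A) = pos_atoms A.
Proof. by elim: A => //= A -> B ->. Qed.

(** * Formulas with restricted polarities; finite conjunctions and disjunctions *)

(** The two polarities are bounded separately: this is what yields Lyndon rather than merely Craig
    interpolants. *)
Definition over (Atom : Type) (P N : pred Atom) (C : form Atom) : bool :=
  all P (pos_atoms C) && all N (neg_atoms C).

Lemma over_And (Atom : Type) (P N : pred Atom) (C D : form Atom) :
  over P N (And C D) = over P N C && over P N D.
Proof. by rewrite /over /= !all_cat andbACA. Qed.

Lemma over_Or (Atom : Type) (P N : pred Atom) (C D : form Atom) :
  over P N (Or C D) = over P N C && over P N D.
Proof. exact: over_And. Qed.

Definition conj (Atom : Type) : seq (form Atom) -> form Atom := foldr (@And _) Top.
Definition disj (Atom : Type) : seq (form Atom) -> form Atom := foldr (@Or _) Bot.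

Lemma over_conj (Atom : Type) (P N : pred Atom) (s : seq (form Atom)) :
  over P N (conj s) = all (over P N) s.
Proof. by elim: s => //= C s <-; rewrite over_And. Qed.

Lemma over_disj (Atom : Type) (P N : pred Atom) (s : seq (form Atom)) :
  over P N (disj s) = all (over P N) s.
Proof. by elim: s => //= C s <-; rewrite over_Or. Qed.

Lemma sat_conj_map (Atom : Type) (T : eqType) (M : model Atom) (w : M)
    (F : T -> form Atom) (s : seq T) :
  sat w (conj (map F s)) <-> forall i, i \in s -> sat w (F i).
Proof.
elim: s => [|i s IHs] /=; first by split.
rewrite IHs; split=> [[Fi Fs] j|Fs]; first by rewrite inE => /orP[/eqP->|/Fs].
by split=> [|j js]; apply: Fs; rewrite inE ?eqxx// js orbT.
Qed.

Lemma sat_disj_map (Atom : Type) (T : eqType) (M : model Atom) (w : M)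
    (F : T -> form Atom) (s : seq T) :
  sat w (disj (map F s)) <-> exists2 i, i \in s & sat w (F i).
Proof.
elim: s => [|i s IHs] /=; first by split=> // -[].
rewrite IHs; split=> [[Fi|[j js Fj]]|[j]].
- by exists i; rewrite ?mem_head.
- by exists j; rewrite // inE js orbT.
- by rewrite inE => /orP[/eqP->|js Fj]; [left|right; exists j].
Qed.

(** * Countability of the set of formulas *)

Fixpoint tree_of_form (Atom : Type) (A : form Atom) : GenTree.tree Atom :=
  match A with
  | Pos p => GenTree.Leaf p
  | Neg p => GenTree.Node 0 [:: GenTree.Leaf p]
  | Top => GenTree.Node 1 [::]
  | Bot => GenTree.Node 2 [::]
  | And A B => GenTree.Node 3 [:: tree_of_form A; tree_of_form B]
  | Or A B => GenTree.Node 4 [:: tree_of_form A; tree_of_form B]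
  | Box A => GenTree.Node 5 [:: tree_of_form A]
  | Dia A => GenTree.Node 6 [:: tree_of_form A]
  end.

Fixpoint form_of_tree (Atom : Type) (t : GenTree.tree Atom) : form Atom :=
  match t with
  | GenTree.Leaf p => Pos p
  | GenTree.Node 0 [:: GenTree.Leaf p] => Neg p
  | GenTree.Node 1 _ => Top
  | GenTree.Node 3 [:: t; u] => And (form_of_tree t) (form_of_tree u)
  | GenTree.Node 4 [:: t; u] => Or (form_of_tree t) (form_of_tree u)
  | GenTree.Node 5 [:: t] => Box (form_of_tree t)
  | GenTree.Node 6 [:: t] => Dia (form_of_tree t)
  | _ => Bot
  end.

Lemma tree_of_formK (Atom : Type) :
  cancel (@tree_of_form Atom) (@form_of_tree Atom).
Proof. by elim=> //= [A -> B ->|A -> B ->|A ->|A ->]. Qed.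

Lemma form_enum (Atom : countType) :
  exists e : nat -> form Atom, forall A, exists n, e n = A.
Proof.
exists (fun n => if @unpickle (GenTree.tree Atom) n is Some t
                 then form_of_tree t else Top) => A.
by exists (pickle (tree_of_form A)); rewrite pickleK tree_of_formK.
Qed.

(** * Ultraproducts of frames and models *)

Definition ueq (U : set_system nat) (T : nat -> Type) (f g : forall n, T n) : Prop :=
  U [set n | f n = g n].

(* A point is an equivalence class of sequences, kept as a set so that
   Leibniz equality of points is equality almost everywhere. *)
Definition upoint (U : set_system nat) (T : nat -> Type) : Type :=
  {c : set (forall n, T n) | exists f, c = ueq U f}.

Definition urepr (U : set_system nat) (T : nat -> Type) (c : upoint U T) :
  forall n, T n := sval (cid (svalP c)).

Definition uclass (U : set_system nat) (T : nat -> Type) (f : forall n, T n) :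
  upoint U T := exist _ (ueq U f) (ex_intro _ f erefl).

Lemma urepr_uclass (U : set_system nat) (FU : Filter U) (T : nat -> Type)
    (f : forall n, T n) : ueq U f (urepr (uclass U f)).
Proof.
rewrite /urepr; case: cid => g /= ->.
by apply: filterS filterT => n.
Qed.

(** Almost everywhere equality is transitive, so both classes have the same members. Heads [HeadEq]
    need this genuine equality of points. *)
Lemma upoint_eq (U : set_system nat) (FU : Filter U) (T : nat -> Type)
    (c d : upoint U T) : ueq U (urepr c) (urepr d) -> c = d.
Proof.
rewrite /urepr; case: cid => f /=; case: cid => g /=.
case: c d => c ? [d ?] /= dg cf fg; apply: eq_exist.
rewrite dg cf; apply/predeqP => h.
by split=> [fh|gh]; [apply: filterS2 fg fh|apply: filterS2 fg gh] => n /= ->.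
Qed.

Lemma dependent_choice_fun (I : Type) (T : I -> Type) (P : forall i, T i -> Prop) :
  (forall i, exists x, P i x) -> exists f, forall i, P i (f i).
Proof. by move=> ex; exists (fun i => sval (cid (ex i))) => i; case: cid. Qed.

Lemma inhabited_upoint (U : set_system nat) (T : nat -> Type) :
  (forall n, inhabited (T n)) -> inhabited (upoint U T).
Proof.
move=> T0; have [|f _] := @dependent_choice_fun _ T (fun _ _ => True).
  by move=> n; have [x] := T0 n; exists x.
exact: (inhabits (uclass U f)).
Qed.

Definition uframe (U : set_system nat) (F : nat -> frame) : frame :=
  @Frame (upoint U F) (fun c d => U [set n | acc (urepr c n) (urepr d n)])
         (inhabited_upoint U (fun n => world_inhabited (F n))).

Definition umodel (Atom : Type) (U : set_system nat) (M : nat -> model Atom) :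
  model Atom :=
  @Model Atom (uframe U M) (fun p c => U [set n | Defs.val p (urepr c n)]).

Lemma ultra_not (U : set_system nat) (UU : UltraFilter U) (P : set nat) :
  U (~` P) <-> ~ U P.
Proof.
split=> [UnP UP|nUP]; last by have [] := in_ultra_setVsetC P UU.
by apply: (@filter_not_empty _ U); apply: filterS2 UnP UP => n nP /nP.
Qed.

Lemma ultra_or (U : set_system nat) (UU : UltraFilter U) (P Q : set nat) :
  U (P `|` Q) <-> U P \/ U Q.
Proof.
split=> [UPQ|[]]; [|exact: filterS (@subsetUl _ _ _)|exact: filterS (@subsetUr _ _ _)].
have [|/(ultra_not UU) nP] := EM (U P); [by left|right].
by apply: filterS2 UPQ nP => n [].
Qed.

(** Łoś's theorem for modal formulas: negation and disjunction use that [U] is ultra, the modalities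
    choose witnesses componentwise. *)
Lemma los (Atom : Type) (U : set_system nat) (UU : UltraFilter U)
    (M : nat -> model Atom) (C : form Atom) (c : umodel U M) :
  sat c C <-> U [set n | sat (urepr c n) C].
Proof.
elim: C c => [p|p|||C IHC D IHD|C IHC D IHD|C IHC|C IHC] c.
- by split.
- by rewrite -[X in U X]/(~` [set n | Defs.val p (urepr c n)]) ultra_not.
- by split=> // _; apply: filterS filterT.
- by split=> // /filter_not_empty.
- rewrite /= IHC IHD; split=> [[UC UD]|UCD]; first by apply: filterS2 UC UD.
  by split; apply: filterS UCD => n [].
- by rewrite /= IHC IHD -ultra_or.
- split=> [boxC|UC d cd]; last first.
    by apply/IHC; apply: filterS2 UC cd => n /[apply].
  apply: contrapT => /(ultra_not UU) nUC.
  (* Components where the box fails get a refuting successor; in the others any world will do, and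
     [urepr c n] is at hand. *)
  have [|f fP] := @dependent_choice_fun _ M (fun n u =>
      ~ sat (urepr c n) (Box C) -> acc (urepr c n) u /\ ~ sat u C).
    move=> n; have [nB|nnB] := EM (~ sat (urepr c n) (Box C)); last first.
      by exists (urepr c n).
    by move/existsNP: (nB) => [u /not_implyP[cu nC]]; exists u.
  have Uf : ueq U f (urepr (uclass U f)) by exact: urepr_uclass.
  have /IHC UfC : sat (uclass U f : umodel U M) C.
    apply: boxC; apply: filterS2 nUC Uf => n /fP[cf _] /= <- //.
  apply: (@filter_not_empty _ U).
  by apply: filterS3 nUC Uf UfC => n /fP[_ nC] /= <-.
- split=> [[d cd /IHC dC]|UC].
    by apply: filterS2 cd dC => n cd dC; exists (urepr d n).
  have [|f fP] := @dependent_choice_fun _ M (fun n u =>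
      sat (urepr c n) (Dia C) -> acc (urepr c n) u /\ sat u C).
    move=> n; have [[u cu uC]|nD] := EM (sat (urepr c n) (Dia C)).
      by exists u.
    by exists (urepr c n).
  have Uf : ueq U f (urepr (uclass U f)) by exact: urepr_uclass.
  exists (uclass U f).
    by apply: filterS2 UC Uf => n /fP[cf _] /= <-.
  by apply/IHC; apply: filterS2 UC Uf => n /fP[_ fC] /= <-.
Qed.

Lemma filter_all (T : eqType) (U : set_system nat) (FU : Filter U) (s : seq T)
    (P : T -> set nat) :
  (forall i, i \in s -> U (P i)) -> U [set n | forall i, i \in s -> P i n].
Proof.
elim: s => [|i s IHs] Ps; first by apply: filterS filterT.
have {}IHs := IHs (fun j js => Ps j (@mem_behead _ (i :: s) j js)).
apply: filterS2 (Ps i (mem_head _ _)) IHs => n Pi Psn j.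
by rewrite inE => /orP[/eqP->|/Psn].
Qed.

(** A body has finitely many atoms, so they hold together on one set of [U], and there the head
    follows in each component; [HeadBot] would put the empty set in [U]. *)
Lemma uframe_horn (U : set_system nat) (UU : UltraFilter U) (F : nat -> frame)
    (H : horn_clause -> Prop) :
  (forall n, horn_class H (F n)) -> horn_class H (uframe U F).
Proof.
move=> HF [b Q] Hh s bs.
have UQ : U [set n | head_holds (fun v => urepr (s v) n) Q].
  have /filterS : U [set n | forall wu, wu \in b ->
      acc (urepr (s wu.1) n) (urepr (s wu.2) n)].
    by apply: filter_all => -[w u] /bs.
  apply=> n bn; apply: (HF n _ Hh) => w u; exact: bn.
by case: Q UQ {Hh bs} => //= [v z|/filter_not_empty//]; apply: upoint_eq.
Qed.

(** * Modal saturation of ultraproducts *)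

Definition saturated (Atom : Type) (M : model Atom) : Prop :=
  forall (D : nat -> form Atom) (x : M),
    (forall k, exists2 y, acc x y & forall i, i < k -> sat y (D i)) ->
    exists2 y, acc x y & forall i, sat y (D i).

Lemma umodel_saturated (Atom : Type) (U : set_system nat) (UU : UltraFilter U)
    (M : nat -> model Atom) :
  (forall k, U [set n | k <= n]) -> saturated (umodel U M).
Proof.
move=> Ucofin D x Dx.
pose good n k (y : M n) := acc (urepr x n) y /\ forall i, i < k -> sat y (D i).
have goodU k : U [set n | exists y, @good n k y].
  have [y xy yD] := Dx k.
  have /filterS2 : U [set n | forall i, i \in iota 0 k -> sat (urepr y n) (D i)].
    by apply: filter_all => i; rewrite mem_iota /= => /yD/(los UU).
  apply; last exact: xy.
  move=> n /= yDn xyn; exists (urepr y n); split=> // i ik.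
  by apply: yDn; rewrite mem_iota.
(* Diagonal choice: in component [n] take a successor meeting the longest attainable initial segment
   of [D], up to length [n]; it meets all shorter segments too. *)
have [|f fP] := @dependent_choice_fun _ M (fun n y =>
    forall k, k <= n -> (exists z, @good n k z) -> good n k y).
  move=> n; suff : forall m, exists y, forall k, k <= m ->
      (exists z, @good n k z) -> good n k y by apply.
  elim=> [|m [y yP]].
    have [[y yP]|nP] := EM (exists y, @good n 0 y).
      by exists y => k; rewrite leqn0 => /eqP->.
    by exists (urepr x n) => k; rewrite leqn0 => /eqP->.
  have [[z [xz zD]]|nP] := EM (exists y, @good n m.+1 y).
    by exists z => k km _; split=> // i ik; apply: zD; apply: leq_trans km.
  by exists y => k; rewrite leq_eqVlt => /orP[/eqP->//|/yP].
have fgood k : U [set n | good n k (urepr (uclass U f) n)].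
  apply: filterS3 (Ucofin k) (goodU k) (urepr_uclass _ f) => n kn gn /= <-.
  exact: fP.
exists (uclass U f); first by apply: filterS (fgood 0) => n [].
by move=> i; apply/(los UU); apply: filterS (fgood i.+1) => n [_]; apply.
Qed.

(** * Inclusion of theories as a directed bisimulation *)

Definition theory_le (Atom : Type) (P N : pred Atom) (M M' : model Atom)
    (x : M) (y : M') : Prop :=
  forall C, over P N C -> sat x C -> sat y C.

(** For finitely many formulas of the language true at [x'], the diamond of their conjunction holds
    at [x], hence at [y]; saturation then finds one [y'] for all of them. *)
Lemma theory_le_forth (Atom : countType) (P N : pred Atom) (M M' : model Atom)
    (x x' : M) (y : M') :
  saturated M' -> theory_le P N x y -> acc x x' ->
  exists2 y', acc y y' & theory_le P N x' y'.
Proof.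
move=> satM' xy xx'; have [e eP] := form_enum Atom.
pose D i := if `[< over P N (e i) /\ sat x' (e i) >] then e i else Top.
have DP i : over P N (D i) /\ sat x' (D i) by rewrite /D; case: asboolP.
have [k|y' yy' y'D] := satM' D y.
  have : sat y (Dia (conj (map D (iota 0 k)))).
    apply: xy => /=.
      rewrite -[over _ _ _]/(over P N (conj _)) over_conj all_map.
      by apply/allP => i _; apply: (DP i).1.
    by exists x' => //; apply/sat_conj_map => i _; apply: (DP i).2.
  case=> y' yy' /sat_conj_map y'D; exists y' => // i ik.
  by apply: y'D; rewrite mem_iota.
exists y' => // C; have [i <-] := eP C => Ci x'C.
by have := y'D i; rewrite /D asboolT.
Qed.

(** Contraposition, since [dual] exchanges the polarities. It reduces the back condition to the
    forth condition. *)
Lemma theory_le_dual (Atom : Type) (P N : pred Atom) (M M' : model Atom)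
    (x : M) (y : M') : theory_le P N x y -> theory_le N P y x.
Proof.
move=> xy C NPC yC; apply: contrapT => /sat_dual xC.
apply: (proj1 (sat_dual C y)) yC; apply: xy xC.
by rewrite /over pos_atoms_dual neg_atoms_dual andbC.
Qed.

Lemma theory_le_back (Atom : countType) (P N : pred Atom) (M M' : model Atom)
    (x : M) (y y' : M') :
  saturated M -> theory_le P N x y -> acc y y' ->
  exists2 x', acc x x' & theory_le P N x' y'.
Proof.
move=> satM /theory_le_dual xy yy'.
by have [x' ? /theory_le_dual] := theory_le_forth satM xy yy'; exists x'.
Qed.

(** * Amalgamation inside a product of frames *)

(** In negation normal form truth is monotone in positive and antitone in negative atoms, so
    one-sided conditions on the valuations suffice. *)
Lemma bounded_morphism_sat (Atom : eqType) (K M : model Atom) (f : K -> M)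
    (A : form Atom) :
  (forall k l, acc k l -> acc (f k) (f l)) ->
  (forall k u, acc (f k) u -> exists2 l, acc k l & f l = u) ->
  (forall k p, p \in pos_atoms A -> Defs.val p (f k) -> Defs.val p k) ->
  (forall k p, p \in neg_atoms A -> Defs.val p k -> Defs.val p (f k)) ->
  forall k, sat (f k) A -> sat k A.
Proof.
move=> fwd bwd.
elim: A => [p|p|||C IHC D IHD|C IHC D IHD|C IHC|C IHC] //= fpos fneg k.
- by apply: fpos; rewrite mem_head.
- by move=> nfp /fneg; rewrite mem_head => /(_ isT).
- move=> [kC kD]; split; [apply: IHC kC|apply: IHD kD] => l p pC.
  + by apply: fpos; rewrite mem_cat pC.
  + by apply: fneg; rewrite mem_cat pC.
  + by apply: fpos; rewrite mem_cat pC orbT.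
  + by apply: fneg; rewrite mem_cat pC orbT.
- move=> [kC|kD]; [left; apply: IHC kC|right; apply: IHD kD] => l p pC.
  + by apply: fpos; rewrite mem_cat pC.
  + by apply: fneg; rewrite mem_cat pC.
  + by apply: fpos; rewrite mem_cat pC orbT.
  + by apply: fneg; rewrite mem_cat pC orbT.
- by move=> kC l /fwd/kC; apply: IHC.
- by move=> [u /bwd[l kl <-] lC]; exists l => //; apply: IHC.
Qed.

(** The maps [f] and [g] jointly embed [K] as a substructure of the product of [F] and [G]; a head
    true in both coordinates is true in [K]. *)
Lemma product_horn (K F G : frame) (f : K -> F) (g : K -> G)
    (H : horn_clause -> Prop) :
  (forall k l, acc k l <-> acc (f k) (f l) /\ acc (g k) (g l)) ->
  (forall k l, f k = f l -> g k = g l -> k = l) ->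
  horn_class H F -> horn_class H G -> horn_class H K.
Proof.
move=> accK injK HF HG h Hh s bs.
have {HF} : head_holds (f \o s) (Defs.head h).
  by apply: HF Hh _ _ => w u /bs/accK[].
have {HG} : head_holds (g \o s) (Defs.head h).
  by apply: HG Hh _ _ => w u /bs/accK[].
by case: (Defs.head h) => //= [v z ? ?|v z ? ?]; [apply/accK|apply: injK].
Qed.

(** The forth and back conditions make both projections of [Z] bounded morphisms, so [A] lifts from
    [M] and [dual B] from [N]. *)
Lemma bisimilar_amalgam (Atom : countType) (H : horn_clause -> Prop)
    (A B : form Atom) (M N : model Atom) (x0 : M) (y0 : N) :
  horn_class H M -> horn_class H N -> saturated M -> saturated N ->
  theory_le [pred p | (p \in pos_atoms A) && (p \in pos_atoms B)]
            [pred p | (p \in neg_atoms A) && (p \in neg_atoms B)] x0 y0 ->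
  sat x0 A -> ~ sat y0 B ->
  exists (K : model Atom) (k : K), [/\ horn_class H K, sat k A & ~ sat k B].
Proof.
set P := (X in theory_le X _); set Q := (X in theory_le _ X).
move=> HM HN satM satN xy0 x0A /sat_dual y0B.
pose Z := {k : M * N | theory_le P Q k.1 k.2}.
pose k0 : Z := exist _ (x0, y0) xy0.
pose F := @Frame Z (fun k l => acc (sval k).1 (sval l).1 /\
  acc (sval k).2 (sval l).2) (inhabits k0).
pose f (k : F) : M := (sval k).1; pose g (k : F) : N := (sval k).2.
(* Least valuation making the positive atoms of [A] and [dual B] true where
   they have to be; [theory_le] prevents conflicts with the negative atoms. *)
pose K := @Model Atom F (fun p k => (p \in pos_atoms A /\ Defs.val p (f k)) \/
  (p \in neg_atoms B /\ Defs.val p (g k))).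
exists K, k0; split.
- apply: (product_horn (f := f) (g := g)) HM HN => // -[[x y] ?] [[x' y'] ?].
  by rewrite /f /g /= => xx' yy'; apply: eq_exist; rewrite xx' yy'.
- apply: (bounded_morphism_sat (f := f : K -> M)) (x0A : sat (f k0) A)
    => [k l []//|[[x y] xy] x'|k p pA fp|].
  + move=> /= xx'; have [y' yy' xy'] := theory_le_forth satN xy xx'.
    by exists (exist _ (x', y') xy').
  + by left.
  (* If [p] is true at the pair only because it is true at [y], it must be true at [x]: otherwise
     the common formula [Neg p] would pass from [x] to [y]. *)
  + move=> [[x y] xy] p pA [[//]|[pB yp]]; apply: contrapT => nxp.
    by apply: (xy (Neg p)) yp; rewrite /over //= /Q /= pA pB.
- apply/sat_dual.
  apply: (bounded_morphism_sat (f := g : K -> N)) (y0B : sat (g k0) (dual B))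
    => [k l []//|[[x y] xy] y'|k p|].
  + move=> /= yy'; have [x' xx' xy'] := theory_le_back satM xy yy'.
    by exists (exist _ (x', y') xy').
  + by rewrite pos_atoms_dual; right.
  + move=> [[x y] xy] p; rewrite neg_atoms_dual => pB [[pA xp]|[]//].
    by apply: (xy (Pos p)) xp; rewrite /over /= /P /= pA pB.
Qed.

(** * Finite separation and compactness *)

(* The interpolant is the disjunction of the conjunctions that describe which
   [e i], [i < n], hold at the points of [A] in models of the class. *)
Lemma finite_interpolant (Atom : Type) (C : frame -> Prop) (A B : form Atom)
    (P N : pred Atom) (n : nat) (e : nat -> form Atom) :
  (forall i, over P N (e i)) ->
  (forall (M M' : model Atom) (x : M) (y : M'), C M -> C M' ->
     sat x A -> ~ sat y B -> ~ forall i, i < n -> sat x (e i) -> sat y (e i)) ->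
  exists I : form Atom,
    [/\ over P N I,
        forall M : model Atom, C M -> forall x : M, sat x A -> sat x I
      & forall M : model Atom, C M -> forall x : M, sat x I -> sat x B].
Proof.
move=> eP sep.
pose realized (J : {set 'I_n}) := exists (M : model Atom) (x : M),
  [/\ C M, sat x A & forall i : 'I_n, sat x (e i) <-> i \in J].
(* Only the true formulas are listed: the language need not be closed under negation. *)
pose type_of (J : {set 'I_n}) := conj [seq e (i : 'I_n) | i <- enum J].
exists (disj [seq type_of J | J <- enum {set 'I_n} & `[< realized J >]]); split.
- rewrite over_disj all_map; apply/allP => J _ /=.
  by rewrite over_conj all_map; apply/allP => i _; apply: eP.
- move=> M CM x xA; apply/sat_disj_map.
  exists [set i : 'I_n | `[< sat x (e i) >]]%SET.
    rewrite mem_filter mem_enum andbT; apply/asboolP; exists M, x.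
    by split=> // i; rewrite inE; split=> /asboolP.
  by apply/sat_conj_map => i; rewrite mem_enum inE => /asboolP.
- move=> M CM y /sat_disj_map[J]; rewrite mem_filter => /andP[/asboolP].
  (* Every [e i] true at the point [x] realizing [J] is true at [y], so [sep] rules out that [B]
     fails at [y]. *)
  move=> [M' [x [CM' xA xJ]]] _ /sat_conj_map yJ; apply: contrapT => nyB.
  apply: (sep _ _ x y) => // i ni.
  by rewrite (xJ (Ordinal ni)) => iJ; apply: (yJ (Ordinal ni)); rewrite mem_enum.
Qed.

Lemma compactness_saturation (Atom : countType) (H : horn_clause -> Prop)
    (A B : form Atom) (P N : pred Atom) :
  (forall n (e : nat -> form Atom), (forall i, over P N (e i)) ->
     exists (M M' : model Atom) (x : M) (y : M'),
     [/\ horn_class H M /\ horn_class H M', sat x A, ~ sat y B &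
         forall i, i < n -> sat x (e i) -> sat y (e i)]) ->
  exists (M M' : model Atom) (x : M) (y : M'),
    [/\ horn_class H M /\ saturated M, horn_class H M' /\ saturated M',
        sat x A, ~ sat y B & theory_le P N x y].
Proof.
have [e0 e0P] := form_enum Atom.
pose e i := if over P N (e0 i) then e0 i else Top.
have eP i : over P N (e i) by rewrite /e; case: ifP.
move=> ex; have /choice[M /choice[M' MP]] := fun n => ex n e eP.
have [x {}MP] := dependent_choice_fun MP.
have [y xyP] := dependent_choice_fun MP.
(* A free ultrafilter: the formula [e i] is transferred in every component [n > i], hence almost
   everywhere. *)
have [U [UU Ucofin]] := ultraFilterLemma eventually_filter.
have Uge k : U [set n | k <= n] by apply: Ucofin; exists k.
have Uxr : ueq U x (urepr (uclass U x)) by exact: urepr_uclass.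
have Uyr : ueq U y (urepr (uclass U y)) by exact: urepr_uclass.
exists (umodel U M), (umodel U M'), (uclass U x), (uclass U y); split.
- split; last exact: umodel_saturated.
  by apply: uframe_horn => n; have [[]] := xyP n.
- split; last exact: umodel_saturated.
  by apply: uframe_horn => n; have [[]] := xyP n.
- by apply/(los UU); apply: filterS Uxr => n /= <-; have [] := xyP n.
- rewrite (los UU) -ultra_not; apply: filterS Uyr => n /= <-.
  by have [] := xyP n.
- move=> C; have [i <-] := e0P C => Ci.
  have ei : e i = e0 i by rewrite /e Ci.
  move=> /(los UU) xi; apply/(los UU).
  apply: filterS3 Uyr (Uge i.+1) (filterI xi Uxr) => n /= <- ni [/[swap] <-].
  by rewrite -ei; have [_ _ _] := xyP n; apply.
Qed.

(** * Interpolation for Horn classes *)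

Lemma LIP_CIP (Atom : eqType) (L : form Atom -> Prop) : LIP L -> CIP L.
Proof.
move=> lip A B /lip[C [AC CB posC negC]]; exists C; split=> // p.
by rewrite /atoms !mem_cat => /orP[/posC|/negC] [-> ->]; rewrite ?orbT.
Qed.

Theorem theorem26 (Atom : countType) (H : horn_clause -> Prop)
    (L : form Atom -> Prop) (hL : complete_wrt L (horn_class H)) :
  LIP L /\ CIP L.
Proof.
suff lip : LIP L by split=> //; apply: LIP_CIP.
move=> A B /hL AB.
pose P := [pred p | (p \in pos_atoms A) && (p \in pos_atoms B)].
pose N := [pred p | (p \in neg_atoms A) && (p \in neg_atoms B)].
(* A semantic interpolant over the class is enough, by completeness; its absence is refuted in the
   second case. *)
have [[I [/andP[IP IN] AI IB]]|nI] := EM (exists I : form Atom,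
    [/\ over P N I,
        forall M : model Atom, horn_class H M -> forall x : M, sat x A -> sat x I
      & forall M : model Atom, horn_class H M -> forall x : M, sat x I -> sat x B]).
  exists I; split.
  - by apply/hL => M HM w; apply/sat_impl; apply: AI.
  - by apply/hL => M HM w; apply/sat_impl; apply: IB.
  - by move=> p /(allP IP)/andP.
  - by move=> p /(allP IN)/andP.
have [n e eP|M [M' [x [y [[HM satM] [HM' satM'] xA nyB xy]]]]] :=
    @compactness_saturation _ H A B P N.
  (* Without such a pair of models for some [n], the first [n] formulas would already give an
     interpolant. *)
  apply: contrapT => noM; apply: nI; apply: (finite_interpolant (n := n)) eP _.
  move=> M M' x y HM HM' xA nyB xy; apply: noM.
  by exists M, M', x, y.
have [K [k [HK kA nkB]]] := bisimilar_amalgam HM HM' satM satM' xy xA nyB.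
by have /sat_impl/(_ kA) := AB K HK k.
Qed.
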